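(* Let $G$ be a finite abelian group. Then: (1) If $G$ has no elements of order $2$, then $G$ admits an antiautomorphism. (2) If $G$ has exactly one element of order $2$, then $G$ does not admit antiautomorphisms. (3) If $G=\mathbf{Z}_{2^{m}}^{n}$, where $n \geq 2$ and $m \geq 1$ are integers, then $G$ admits an antiautomorphism.
   Context: Let $G$ be an abelian group (written additively). A function $f: G \rightarrow G$ (not necessarily a homomorphism) is an antimorphism if the map $\mathrm{id}_{G}-f$, $x \mapsto x-f(x)$, is injective. An antiautomorphism of $G$ is an antimorphism $f: G\to G$ that is a bijection. $\mathbf{Z}_{k}$ denotes the additive group of integers modulo $k$, and $\mathbf{Z}_{k}^{n}$ denotes the direct sum of $n$ copies of $\mathbf{Z}_{k}$. *)

(* Defs.v *)
From HB Require Import structures.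
From mathcomp Require Import all_boot all_order all_fingroup all_algebra.

Set Implicit Arguments.
Unset Strict Implicit.
Unset Printing Implicit Defensive.

Import GRing.Theory.
Local Open Scope ring_scope.

Definition antimorphism (G : zmodType) (f : G -> G) : Prop :=
  injective (fun x => x - f x).

Definition antiautomorphism (G : zmodType) (f : G -> G) : Prop :=
  antimorphism f /\ bijective f.

(* The finGroupType carried by a finZmodType is its additive group, so #[x]%g
   is the additive order of x and \isog is isomorphism of additive groups.    *)
Fact finZmod_mulgE (G : finZmodType) (x y : G) : (x * y)%g = x + y.
Proof. by []. Qed.

(* Main.v *)
Require Import Defs.
From HB Require Import structures.
From mathcomp Require Import all_boot all_order all_fingroup all_algebra.
From mathcomp Require Import cyclic.

(** If [G] has no involution, [x |-> - x] is an antiautomorphism, because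
    doubling, [x - (- x) = x *+ 2], has trivial kernel.

    If [f] is an antiautomorphism of a finite [G], then [f] and [id - f] both
    permute [G], so summing [x - f x] over [G] gives [s = s - s], where [s] is
    the sum of all elements of [G] ([antiautomorphism_sum_eq0]). Elements that
    differ from their opposites cancel in pairs, so [s] is the sum of the
    elements killed by 2 ([sum_all_sum_2torsion]); when there is exactly one
    involution [t], this is [0 + t], which is nonzero.

    On a power [H ^ n] with [n >= 2], consider sequences satisfying
    [u_(i + n) = u_i + u_(i + 1)], each determined by its first [n] terms. The
    shift of such sequences induces an additive map [recurrence_shift] on
    [H ^ n]. It is injective because [u_0 = u_n - u_1], and it fixes no nonzero
    vector because a constant solution [c] satisfies [c = c + c]. (It is the
    companion map of [X^n - X - 1], whose values at 0 and at 1 are both the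
    unit [-1].) On a finite group, that makes it an antiautomorphism, which is
    then transported along the isomorphism. *)

Set Implicit Arguments.
Unset Strict Implicit.
Unset Printing Implicit Defensive.

Import GRing.Theory.
Local Open Scope ring_scope.

(** For an additive [f], injectivity of [f] and of [id - f] are conditions on
    their kernels, and finiteness makes the injective [f] bijective. *)
Lemma additive_antiautomorphism (G : finZmodType) (f : {additive G -> G}) :
  (forall x, f x = 0 -> x = 0) -> (forall x, f x = x -> x = 0) ->
  antiautomorphism f.
Proof.
move=> f_ker f_fix; split.
  move=> x y /= xy; apply/eqP; rewrite -subr_eq0; apply/eqP/f_fix/eqP.
  rewrite raddfB -[in X in _ == X](subrK (f x) x) xy -[y - f y + _]addrA.
  by rewrite addrAC subrr add0r addrC.
apply: injF_bij => x y /eqP; rewrite -subr_eq0 -raddfB => /eqP /f_ker /eqP.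
by rewrite subr_eq0 => /eqP.
Qed.

Lemma order_eq2 (G : finZmodType) (x : G) :
  (#[x]%g == 2%N) = (x != 0) && (x + x == 0).
Proof.
apply/idP/andP => [/eqP o2 | [x0 /eqP xx0]].
  split; first by apply/eqP => x0; move: o2; rewrite x0 order1.
  by rewrite -finZmod_mulgE -expg2 -o2 expg_order.
rewrite eqn_leq order_gt1 x0 andbT dvdn_leq // order_dvdn.
by rewrite expg2 finZmod_mulgE xx0.
Qed.

Lemma opp_antiautomorphism (G : finZmodType) :
  ~ (exists x : G, #[x]%g = 2%N) -> antiautomorphism (fun x : G => - x).
Proof.
move=> no2; apply: (@additive_antiautomorphism G -%R) => x.
  by move/eqP; rewrite oppr_eq0 => /eqP.
move=> Nx; apply/eqP; apply/negPn/negP => x0; apply: no2; exists x.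
by apply/eqP; rewrite order_eq2 x0 -{1}Nx addNr eqxx.
Qed.

(** Reindexing the sum [s] of all elements along the permutation [id - f], then
    along [f], gives [s = s - s]. *)
Lemma antiautomorphism_sum_eq0 (G : finZmodType) (f : G -> G) :
  antiautomorphism f -> \sum_(x : G) x = 0.
Proof.
case=> /injF_bij g_bij f_bij.
have := reindex _ (onW_bij _ g_bij) : \sum_(x : G) x = _.
rewrite sumrB -(reindex f (P := predT) (F := id)) ?subrr //.
exact: onW_bij.
Qed.

(** An element that differs from its opposite cancels against it. *)
Lemma sum_all_sum_2torsion (G : finZmodType) :
  \sum_(x : G) x = \sum_(x : G | x + x == 0) x.
Proof.
rewrite (bigID (fun x : G => x + x == 0)) /= -[RHS]addr0; congr (_ + _).
(* An arbitrary total order on G selects one element of each pair {x, - x}. *)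
pose below (x : G) := (enum_rank x < enum_rank (- x)%R)%N.
rewrite (bigID below) /=.
rewrite [X in _ + X](reindex_inj (@oppr_inj G)) /= sumrN.
apply/eqP; rewrite subr_eq0; apply/eqP/eq_bigl => x.
rewrite /below opprK -opprD oppr_eq0 -leqNgt.
case: (boolP (x + x == 0)) => //= xx0.
have /negPf ne_rank : enum_rank x != enum_rank (- x) :> nat.
  apply: contra xx0 => /eqP/val_inj/enum_rank_inj xNx.
  by rewrite {2}xNx subrr.
by rewrite [RHS]leq_eqVlt ne_rank.
Qed.

Lemma sum_eq_unique_involution (G : finZmodType) (t : G) :
  unique (fun x : G => #[x]%g = 2%N) t -> \sum_(x : G) x = t.
Proof.
case=> /eqP; rewrite order_eq2 => /andP[t0 tt0] t_uniq.
rewrite sum_all_sum_2torsion (bigD1 t) //= (bigD1 0) /=; last first.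
  by rewrite addr0 eqxx eq_sym.
rewrite big1 ?addr0 // => x /andP[/andP[xx0 xt] x0].
by case/eqP: xt; apply/esym/t_uniq/eqP; rewrite order_eq2 x0.
Qed.

(** Advances the window [(u_0, ..., u_(n-1))], with [n = k.+2], of a solution of
    [u_(i + n) = u_i + u_(i + 1)] to [(u_1, ..., u_n)]. *)
Definition recurrence_shift (H : zmodType) (k : nat) (v : 'rV[H]_k.+2) :
  'rV[H]_k.+2 :=
  \row_i (if (i < k.+1)%N then v 0 (inord i.+1) else v 0 0 + v 0 1).

Fact recurrence_shift_is_zmod_morphism (H : zmodType) (k : nat) :
  zmod_morphism (@recurrence_shift H k).
Proof.
move=> u v; apply/rowP => i; rewrite !mxE.
by case: ifP => // _; rewrite opprD addrACA.
Qed.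

HB.instance Definition _ (H : zmodType) (k : nat) :=
  GRing.isZmodMorphism.Build 'rV[H]_k.+2 'rV[H]_k.+2 (@recurrence_shift H k)
    (@recurrence_shift_is_zmod_morphism H k).

Lemma recurrence_shift_succ (H : zmodType) (k : nat) (v : 'rV[H]_k.+2) i :
  (i < k.+1)%N -> recurrence_shift v 0 (inord i) = v 0 (inord i.+1).
Proof. by move=> ik; rewrite mxE inordK ?ik // ltnW. Qed.

Lemma recurrence_shift_last (H : zmodType) (k : nat) (v : 'rV[H]_k.+2) :
  recurrence_shift v 0 ord_max = v 0 0 + v 0 (inord 1).
Proof.
by rewrite mxE ltnn; congr (_ + v 0 _); apply: val_inj; rewrite /= inordK.
Qed.

(** The entries of positive index are those that the shift moves, so they
    vanish; the recurrence then gives [u_0 = u_n - u_1 = 0]. *)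
Lemma recurrence_shift_ker (H : zmodType) (k : nat) (v : 'rV[H]_k.+2) :
  recurrence_shift v = 0 -> v = 0.
Proof.
move=> Sv0.
have v_pos i : (i < k.+1)%N -> v 0 (inord i.+1) = 0.
  by move=> ik; rewrite -recurrence_shift_succ // Sv0 mxE.
apply/rowP => j; rewrite [RHS]mxE.
case: j => [[|j] jk]; last first.
  by rewrite -(v_pos j jk); congr (v 0 _); apply: val_inj; rewrite /= inordK.
have := recurrence_shift_last v; rewrite Sv0 mxE v_pos // addr0 => ->.
by congr (v 0 _); apply: val_inj.
Qed.

(** A window fixed by the shift is constant, and the recurrence forces its
    value [c] to satisfy [c = c + c]. *)
Lemma recurrence_shift_fix (H : zmodType) (k : nat) (v : 'rV[H]_k.+2) :
  recurrence_shift v = v -> v = 0.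
Proof.
move=> Svv.
have v_const i : (i < k.+2)%N -> v 0 (inord i) = v 0 (inord 0).
  elim: i => // i IHi ik.
  by rewrite -(IHi (ltnW ik)) -recurrence_shift_succ // Svv.
have v_constE j : v 0 j = v 0 (inord 0) by rewrite -(v_const j) ?inord_val.
have := recurrence_shift_last v.
rewrite Svv !v_constE => /eqP; rewrite -subr_eq0 opprD addrA subrr sub0r.
by rewrite oppr_eq0 => /eqP v0; apply/rowP => j; rewrite v_constE v0 mxE.
Qed.

Lemma isog_antiautomorphism (G K : finZmodType) (f : K -> K) :
  [set: G] \isog [set: K] -> antiautomorphism f ->
  exists f' : G -> G, antiautomorphism f'.
Proof.
case/isogP => phi /injmP phi_inj phi_im [f_anti f_bij].
have phiD (x y : G) : phi (x + y) = phi x + phi y.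
  by rewrite -!finZmod_mulgE morphM ?inE.
have injphi : injective phi by move=> x y; apply: phi_inj; rewrite inE.
have [psi phiK psiK] : bijective phi.
  apply: inj_card_bij => //.
  by rewrite -!cardsT -phi_im card_injm //; apply/injmP.
exists (psi \o f \o phi); split; last first.
  by apply: bij_comp; [apply: bij_comp => // | ]; [exists phi | exists psi].
have phiB (x y : G) : phi (x - y) = phi x - phi y.
  by apply/eqP; rewrite eq_sym subr_eq -phiD subrK.
move=> x y /(congr1 phi); rewrite !phiB /= !psiK.
by move/f_anti/injphi.
Qed.

Theorem theorem3p8 (G : finZmodType) :
  [/\ (~ exists x : G, #[x]%g = 2%N) ->
        exists f : G -> G, antiautomorphism f,
      (exists! x : G, #[x]%g = 2%N) ->
        ~ exists f : G -> G, antiautomorphism f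
    & forall m n : nat, (2 <= n)%N -> (1 <= m)%N ->
        [set: G] \isog [set: 'rV['Z_(2 ^ m)]_n] ->
        exists f : G -> G, antiautomorphism f].
Proof.
split.
- by move=> no2; exists (fun x => - x); apply: opp_antiautomorphism.
- move=> [t t_uniq] [f /antiautomorphism_sum_eq0].
  rewrite (sum_eq_unique_involution t_uniq) => t0.
  by case: t_uniq => /eqP; rewrite order_eq2 t0 eqxx.
move=> m [|[|k]] // _ _ /isog_antiautomorphism; apply.
apply: (@additive_antiautomorphism _ (@recurrence_shift _ k)).
  exact: recurrence_shift_ker.
exact: recurrence_shift_fix.
Qed.
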